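(* Let $\alpha$ be an admissible assigning of a graph $G$ and $\prec$ a linear ordering on $E(G)$. Write the cycle-assigning polynomial as $P(G,\alpha;k)=\sum_{i=0}^{r(G)}(-1)^{i}w_i(G,\alpha)k^{|V(G)|-i}$. Then each unsigned coefficient $w_i(G,\alpha)$ is the number of $\alpha$-compatible spanning subgraphs of $G$ that have exactly $i$ edges and do not contain broken $\alpha$-compatible cycles with respect to $\prec$.
   Context: Graphs are finite and may have loops and multiple edges; Abelian groups $A$ are additive and finite; $D$ is a fixed orientation of $G$. A cycle of $G$ is a connected 2-regular subgraph (a loop with its vertex is a cycle with one edge; two parallel edges form a cycle); $\mathcal{C}(G)$ is the set of cycles. An assigning of $G$ is a map $\alpha:\mathcal{C}(G)\to\{0,1\}$. For each cycle $C$ fix one of its two directions $o(C)$ and define $\eta_{D(C)}:E(G)\to\{0,\pm1\}$ by $\eta_{D(C)}(e)=1$ if $e\in E(C)$ and the direction of $e$ under $D$ is consistent with $o(C)$, $-1$ if $e\in E(C)$ and the direction of $e$ is opposite to $o(C)$, and $0$ if $e\notin E(C)$. For $f:E(G)\to A$, set $\alpha_{D,f}(C)=0$ if $\sum_{e\in E(C)}\eta_{D(C)}(e)f(e)=0$ and $1$ otherwise. An assigning $\alpha$ is admissible if $\alpha=\alpha_{D,f}$ for some finite Abelian group $A$ and some $f:E(G)\to A$ (independent of $D$ and the $o(C)$). A subgraph $H$ of $G$ is $\alpha$-compatible if $\alpha(C)=0$ for every cycle $C$ of $H$. The cycle-assigning polynomial is $P(G,\alpha;k):=\sum_{H}(-1)^{|E(H)|}k^{c(H)}$,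 the sum over all $\alpha$-compatible spanning subgraphs $H$ of $G$ (spanning: $V(H)=V(G)$), where $c(H)$ is the number of components of $H$; $r(G)=|V(G)|-c(G)$. An $\alpha$-compatible cycle of $G$ is a cycle $C$ with $\alpha(C)=0$. A broken $\alpha$-compatible cycle (with respect to $\prec$) is a subgraph obtained from an $\alpha$-compatible cycle by removing its maximal edge with respect to $\prec$ (for a loop $e$ with $\alpha(e)=0$ this is the single vertex, without edges, so it is contained in every spanning subgraph). *)

(* Defs.v *)
From HB Require Import structures.
From mathcomp Require Import all_boot all_order all_algebra.

Set Implicit Arguments.
Unset Strict Implicit.
Unset Printing Implicit Defensive.

Import GRing.Theory.
Local Open Scope ring_scope.

(* Finite graphs with loops and multiple edges.  An edge e has two half-edges,
   (e, false) and (e, true), and [endpt e b] is the vertex at which (e, b) is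
   attached; e is a loop iff [endpt e false = endpt e true].  The labelling of
   the two half-edges is only a reference: it is not the orientation D. *)
Record mgraph := MGraph {
  vertex : finType;
  edge : finType;
  endpt : edge -> bool -> vertex }.

(* An orientation selects the half-edge at the head of each edge, so that a
   loop has two orientations, as any other edge does. *)
Definition orientation (G : mgraph) := edge G -> bool.

Definition head_of (G : mgraph) (D : orientation G) (e : edge G) := endpt e (D e).
Definition tail_of (G : mgraph) (D : orientation G) (e : edge G) := endpt e (~~ D e).

Definition subgraph (G : mgraph) :=
  {H : {set vertex G} * {set edge G} |
     [forall e in H.2, forall b, endpt e b \in H.1]}.
HB.instance Definition _ (G : mgraph) := Finite.on (subgraph G).

Definition VS (G : mgraph) (H : subgraph G) : {set vertex G} := (val H).1.
Definition ES (G : mgraph) (H : subgraph G) : {set edge G} := (val H).2.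

Definition spanning (G : mgraph) (H : subgraph G) : bool := VS H == [set: vertex G].

Definition contained (G : mgraph) (K H : subgraph G) : bool :=
  (VS K \subset VS H) && (ES K \subset ES H).

Lemma full_subproof (G : mgraph) :
  [forall e in ([set: vertex G], [set: edge G]).2, forall b,
     endpt e b \in ([set: vertex G], [set: edge G]).1].
Proof. by apply/forall_inP => e _; apply/forallP => b; rewrite in_setT. Qed.

Definition full (G : mgraph) : subgraph G :=
  exist _ ([set: vertex G], [set: edge G]) (full_subproof G).

Definition adj (G : mgraph) (H : subgraph G) : rel (vertex G) :=
  [rel x y | [exists e in ES H, exists b,
                (endpt e b == x) && (endpt e (~~ b) == y)]].

(* c(H): number of components *)
Definition ncomp (G : mgraph) (H : subgraph G) : nat := n_comp (adj H) (VS H).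

(* r(G) *)
Definition grank (G : mgraph) : nat := (#|vertex G| - ncomp (full G))%N.

(* Half-edges are counted, so a loop contributes 2. *)
Definition degree (G : mgraph) (H : subgraph G) (v : vertex G) : nat :=
  #|[set h : edge G * bool | (h.1 \in ES H) && (endpt h.1 h.2 == v)]|.

Definition is_cycle (G : mgraph) (H : subgraph G) : bool :=
  (ncomp H == 1%N) && [forall v in VS H, degree H v == 2%N].

Definition cycle_of (G : mgraph) := {C : subgraph G | is_cycle C}.
HB.instance Definition _ (G : mgraph) := Finite.on (cycle_of G).

(* [true] stands for 1 and [false] for 0. *)
Definition assigning (G : mgraph) := cycle_of G -> bool.

(* A direction of a cycle C is an orientation of its edges for which every
   vertex of C is the head of exactly one edge of C and the tail of exactly
   one.  The values of d outside of E(C) are irrelevant. *)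
Definition is_direction (G : mgraph) (C : cycle_of G) (d : orientation G) : Prop :=
  forall v, v \in VS (val C) ->
    #|[set e in ES (val C) | head_of d e == v]| = 1%N /\
    #|[set e in ES (val C) | tail_of d e == v]| = 1%N.

Definition eta (G : mgraph) (D : orientation G) (o : cycle_of G -> orientation G)
    (C : cycle_of G) (e : edge G) : int :=
  if e \in ES (val C) then (if D e == o C e then 1 else -1) else 0.

(* alpha_{D,f} *)
Definition induced_assigning (G : mgraph) (D : orientation G)
    (o : cycle_of G -> orientation G) (A : finZmodType) (f : edge G -> A) :
    assigning G :=
  fun C => \sum_(e in ES (val C)) f e *~ eta D o C e != 0.

Definition admissible (G : mgraph) (D : orientation G)
    (o : cycle_of G -> orientation G) (alpha : assigning G) : Prop :=
  exists (A : finZmodType) (f : edge G -> A), alpha =1 induced_assigning D o f.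

Definition compatible (G : mgraph) (alpha : assigning G) (H : subgraph G) : bool :=
  [forall C : cycle_of G, contained (val C) H ==> ~~ alpha C].

Definition cycle_assigning_poly (G : mgraph) (alpha : assigning G) : {poly int} :=
  \sum_(H : subgraph G | spanning H && compatible alpha H)
     (-1) ^+ #|ES H| *: 'X^(ncomp H).

(* w_i(G, alpha), the coefficient of k^(|V(G)| - i) up to the sign (-1)^i
   (meaningful for i <= |V(G)|) *)
Definition unsigned_coef (G : mgraph) (alpha : assigning G) (i : nat) : int :=
  (-1) ^+ i * (cycle_assigning_poly alpha)`_(#|vertex G| - i).

Definition strict_linear_order (T : eqType) (prec : rel T) : Prop :=
  [/\ irreflexive prec, transitive prec &
      forall x y, x != y -> prec x y || prec y x].

Definition is_max_edge (G : mgraph) (prec : rel (edge G)) (C : subgraph G)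
    (e : edge G) : bool :=
  (e \in ES C) && [forall e' in ES C, (e' != e) ==> prec e' e].

Definition is_broken_cycle (G : mgraph) (alpha : assigning G)
    (prec : rel (edge G)) (B : subgraph G) : bool :=
  [exists C : cycle_of G, exists e : edge G,
     [&& ~~ alpha C, is_max_edge prec (val C) e,
         VS B == VS (val C) & ES B == ES (val C) :\ e]].

Definition no_broken_cycle (G : mgraph) (alpha : assigning G)
    (prec : rel (edge G)) (H : subgraph G) : bool :=
  [forall B : subgraph G, is_broken_cycle alpha prec B ==> ~~ contained B H].

(* Main.v *)
Require Import Defs.
From mathcomp Require Import all_boot all_order all_algebra.
From mathcomp Require Import zify.

Import GRing.Theory.
Local Open Scope ring_scope.

Set Implicit Arguments.
Unset Strict Implicit.
Unset Printing Implicit Defensive.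

(** A spanning subgraph is its edge set [S], and it contributes the monomial
    (-1)^|S| k^(c(S)).  Say that [e] closes [S] when some compatible cycle [C]
    has maximal edge [e] and [C - e] lies in [S], that is, when [S] contains
    the broken cycle [C - e].  The proof is a cancellation: on the compatible
    sets that contain a broken cycle, toggle the smallest edge that closes the
    set.

    - This is an involution: whether an edge [a] smaller than or equal to [e]
      closes the set depends only on edges smaller than [a], so toggling [e]
      does not change which edge is the smallest ([first_closing_toggle]).
    - It keeps c(S), since [C - e] already joins the ends of [e]
      ([comps_closes]), and changes the parity of |S|; the two monomials cancel.
    - It keeps compatibility, and this is where admissibility enters
      ([balanced_closes]).  Let [alpha] come from [f : E -> A].  The cycles of
      [S] all have zero [f]-sum exactly when [f] is on [S] the difference of a
      potential on the vertices ([balanced_potential], [potential_zero]).  If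
      [e] closes [S] by the compatible cycle [C], the sums along [C] of [f] and
      of the potential difference both vanish, and they agree off [e], hence on
      [e] too: the same potential works for [S + e] ([potential_extend]).

    The surviving sets are compatible without broken cycle.  They are forests,
    because a cycle in such a set would be compatible and contain a broken
    cycle ([balanced_unbroken_acyclic]).  A forest with [i] edges has |V| - i
    components ([forest_comps]), so it counts for (-1)^i k^(|V| - i), and i is
    at most r(G).

    Two facts link cycles, given as connected 2-regular subgraphs, with
    connectedness: an edge whose ends are joined in [S] lies on a cycle of
    [S + e] ([cycle_through]), and a cycle minus an edge still joins the ends of
    that edge ([cycle_minus_edge_connected]). *)

(** * Edge sets as spanning subgraphs *)

Section EdgeSets.

Variable G : mgraph.
Implicit Types (S T : {set edge G}) (e a : edge G) (x y v : vertex G).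

Lemma spanning_on_subproof S :
  [forall e in ([set: vertex G], S).2, forall b,
     endpt e b \in ([set: vertex G], S).1].
Proof. by apply/forall_inP => e _; apply/forallP => b; rewrite in_setT. Qed.

Definition spanning_on S : subgraph G := exist _ ([set: vertex G], S) (spanning_on_subproof S).

Lemma spanning_on_spanning S : spanning (spanning_on S).
Proof. exact: eqxx. Qed.

Lemma spanning_onK (H : subgraph G) : spanning H -> spanning_on (ES H) = H.
Proof.
by case: H => -[V S] hS /eqP HV; apply: val_inj; rewrite /= -HV.
Qed.

Lemma contained_spanning_on (K : subgraph G) S : contained K (spanning_on S) = (ES K \subset S).
Proof. by rewrite /contained subsetT. Qed.

(** This is convertible to the adjacency of any subgraph with edge set [S], so
    that cycles and spanning subgraphs share one connectedness relation. *)
Definition edge_adj S : rel (vertex G) :=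
  [rel x y | [exists e in S, exists b,
                (endpt e b == x) && (endpt e (~~ b) == y)]].

Definition comps S : nat := n_comp (edge_adj S) (vertex G).

Lemma ncomp_spanning_on S : ncomp (spanning_on S) = comps S.
Proof. by apply: eq_n_comp_r => x; rewrite in_setT. Qed.

Lemma edge_adjP S x y :
  reflect (exists e b, [/\ e \in S, endpt e b = x & endpt e (~~ b) = y])
          (edge_adj S x y).
Proof.
apply: (iffP existsP) => [[e /andP[eS /existsP[b /andP[/eqP <- /eqP <-]]]]|].
  by exists e, b.
move=> [e [b [eS <- <-]]]; exists e; rewrite eS /=.
by apply/existsP; exists b; rewrite !eqxx.
Qed.

Lemma edge_adj_sym S : connect_sym (edge_adj S).
Proof.
apply: sym_connect_sym => x y.
by apply/edge_adjP/edge_adjP => -[e [b [eS <- <-]]]; exists e, (~~ b);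
  rewrite negbK.
Qed.

Lemma connect_edge S e b : e \in S ->
  connect (edge_adj S) (endpt e b) (endpt e (~~ b)).
Proof. by move=> eS; apply/connect1/edge_adjP; exists e, b. Qed.

Lemma sub_edge_adj S T : S \subset T -> subrel (edge_adj S) (edge_adj T).
Proof.
move=> /subsetP sST x y /edge_adjP[e [b [eS <- <-]]].
by apply/edge_adjP; exists e, b; rewrite sST.
Qed.

Lemma sub_connect_edge S T x y : S \subset T ->
  connect (edge_adj S) x y -> connect (edge_adj T) x y.
Proof.
by move=> sST; apply: connect_sub => u v /(sub_edge_adj sST); apply: connect1.
Qed.

Lemma comps0 : comps set0 = #|vertex G|.
Proof.
apply: eq_card => x; rewrite !inE andbT.
suff h y : connect (edge_adj set0) x y -> x = y.
  by apply/eqP/esym/h/connect_root.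
case/connectP=> -[_ -> //|z p /= /andP[/edge_adjP[e [b [+ _ _]]] _] _].
by rewrite inE.
Qed.

(** * Components when an edge is added *)

Lemma comps_cycle_edge S e :
  connect (edge_adj S) (endpt e false) (endpt e true) ->
  comps (e |: S) = comps S.
Proof.
move=> h; apply: eq_n_comp => x y; apply/idP/idP; last first.
  exact/sub_connect_edge/subsetUr.
apply: connect_sub => u v /edge_adjP[a [b [+ <- <-]]].
case/setU1P=> [->|aS]; last exact: connect_edge.
by case: b => //=; rewrite edge_adj_sym.
Qed.

(** Only the classes of the two ends of [e] are affected by the insertion of
    [e]: on the complement of their union the two connectedness relations
    agree, hence so do the representatives that are counted there. *)
Lemma comps_bridge S e :
  ~~ connect (edge_adj S) (endpt e false) (endpt e true) ->
  comps S = (comps (e |: S)).+1.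
Proof.
move=> h.
pose K := closure (edge_adj S) (pred2 (endpt e false) (endpt e true)).
have cK : closed (edge_adj S) K by apply/closure_closed/edge_adj_sym.
have eK b : endpt e b \in K.
  by apply: mem_closure; case: b; rewrite !inE eqxx ?orbT.
have cK' : closed (edge_adj (e |: S)) K.
  apply: intro_closed; first exact: edge_adj_sym.
  move=> x y /edge_adjP[a [b [+ <- <-]]].
  case/setU1P=> [-> _|aS]; first exact: eK.
  by rewrite (closed_connect cK (connect_edge b aS)).
rewrite /comps (n_compC K) (n_compC K (edge_adj (e |: S))) -addSn.
congr (_ + _)%N.
  rewrite /K n_comp_closure2 ?h; last exact: edge_adj_sym.
  have kx : connect (edge_adj (e |: S)) (endpt e false) =i K.
    move=> y; apply/idP/idP => [hy|].
      by rewrite -(closed_connect cK' hy).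
    case/pred0Pn=> z /andP[/= yz] /pred2P zE.
    rewrite -topredE /= edge_adj_sym; apply: connect_trans (_ : connect _ _ z) _.
      exact: sub_connect_edge (subsetUr _ _) yz.
    case: zE => ->; first exact: connect0.
    exact/(connect_edge true)/setU11.
  rewrite -/K -(eq_n_comp_r kx) n_comp_connect //; exact: edge_adj_sym.
apply: eq_card => x; rewrite !inE; apply: andb_id2r => xK.
rewrite /roots /fingraph.root; congr (odflt x _ == x); apply: eq_pick => y.
apply/idP/idP; first exact/sub_connect_edge/subsetUr.
case/connectP=> p + ->; elim: p x xK => [|z p IHp] x xK //=.
case/andP=> xz /IHp hz.
have zK : z \in [predC K] by rewrite !inE -(cK' _ _ xz).
apply: connect_trans (hz zK); apply: connect1.
case/edge_adjP: xz xK => a [b [+ <- <-]].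
case/setU1P=> [->|aS _]; first by rewrite eK.
by apply/edge_adjP; exists a, b.
Qed.

Lemma comps_setU1 S e : (comps (e |: S) <= comps S)%N.
Proof.
have [/comps_cycle_edge-> //|/comps_bridge->//] :=
  boolP (connect (edge_adj S) (endpt e false) (endpt e true)).
Qed.

Lemma comps_setT S : (comps [set: edge G] <= comps S)%N.
Proof.
have [n] := ubnP #|~: S|; elim: n S => // n IHn S leSn.
have [S0|[e eS]] := set_0Vmem (~: S); first by rewrite -(setCK S) S0 setC0.
apply: leq_trans (IHn (e |: S) _) (comps_setU1 S e).
by rewrite setCU setIC -setDE; move: leSn; rewrite (cardsD1 e (~: S)) eS.
Qed.

(** * Cycles from paths, and forests *)

Definition half_degree S v :=
  (\sum_(e in S) ((endpt e false == v) + (endpt e true == v)))%N.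

Lemma degreeE (H : subgraph G) v : degree H v = half_degree (ES H) v.
Proof.
rewrite /degree -sum1dep_card.
rewrite (eq_bigl (fun h => (h.1 \in ES H) && (endpt h.1 h.2 == v))) //.
rewrite -(pair_big_dep (fun e => e \in ES H) (fun e b => endpt e b == v) (fun _ _ => 1%N)) /=.
apply: eq_bigr => e _; rewrite big_mkcond big_bool /= addnC.
by do 2!case: eqP.
Qed.

Lemma half_degree_gt0 S e b : e \in S -> (0 < half_degree S (endpt e b))%N.
Proof.
by move=> eS; rewrite /half_degree (bigD1 e) //=; case: b; rewrite eqxx ?addnS.
Qed.

(** A path along distinct vertices has degree 2 at each of them, except for one
    half-edge missing at each end.  Writing the two missing half-edges on the
    left makes the formula uniform, including for the path without edges,
    whose two ends coincide; an edge that joins the ends then supplies exactly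
    these two terms. *)
Lemma path_edges S x p : path (edge_adj S) x p -> uniq (x :: p) ->
  exists P : {set edge G}, [/\ P \subset S,
    forall v, v \in x :: p -> connect (edge_adj P) x v &
    forall v, (half_degree P v + (v == x) + (v == last x p))%N =
              ((v \in x :: p) * 2)%N].
Proof.
elim: p x => [|z p IHp] x /=.
  move=> _ _; exists set0; split=> [|v|v]; first exact: sub0set.
    by rewrite inE => /eqP->; apply: connect0.
  by rewrite /half_degree big_set0 inE; case: eqP.
case/andP=> /edge_adjP[a [b [aS ax az]]] /IHp{}IHp /andP[xp /IHp[P [PS Pc Pd]]].
(* [x] is off the rest of the path, so no edge of [P] is attached to it. *)
have aP : a \notin P.
  apply: contra xp => aP.
  by have := Pd x; have := half_degree_gt0 b aP; rewrite ax; case: (x \in _) => //; lia.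
exists (a |: P); split.
- by rewrite subUset sub1set aS.
- move=> v; rewrite inE => /predU1P[->|vp]; first exact: connect0.
  rewrite -ax; apply: connect_trans (connect_edge b (setU11 a P)) _.
  by rewrite az; apply: sub_connect_edge (subsetUr _ _) (Pc v vp).
move=> v; rewrite /half_degree big_setU1 //= -/(half_degree P v).
rewrite (in_cons x).
have -> : ((endpt a false == v) + (endpt a true == v) = (v == x) + (v == z))%N.
  by rewrite -ax -az; case: b {ax az}; rewrite /= ![_ == v]eq_sym // addnC.
have := Pd v; case: (v =P x) => [->|_] /=; last lia.
by rewrite (negbTE xp); lia.
Qed.

(** A connection in [S] between the ends of [e], shortened until its vertices
    are distinct, closes up with [e] into a cycle.  For a loop the connection
    has no edge and the cycle is the loop itself. *)
Lemma cycle_through S e : e \notin S ->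
  connect (edge_adj S) (endpt e false) (endpt e true) ->
  exists C : cycle_of G, e \in ES (val C) /\ ES (val C) \subset e |: S.
Proof.
move=> eS /connectP[p0 p0S]; case: (shortenP p0S) => p pS pu _ plast {p0 p0S}.
have [P [PS Pc Pd]] := path_edges pS pu.
have eP : e \notin P by apply: contra eS => /(subsetP PS).
set x := endpt e false in pS pu plast Pc Pd.
have deg v : half_degree (e |: P) v = ((v \in x :: p) * 2)%N.
  rewrite /half_degree big_setU1 //= -/(half_degree P v) -Pd -plast.
  by rewrite ![_ == v]eq_sym addnC addnA.
pose VC := [set v in x :: p].
have inV a b : a \in e |: P -> endpt a b \in VC.
  move=> aC; rewrite inE; have := deg (endpt a b).
  by have := half_degree_gt0 b aC; case: (_ \in _) => //; lia.
have VC_ok : [forall a in (VC, e |: P).2, forall b, endpt a b \in (VC, e |: P).1].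
  by apply/forall_inP => a aC; apply/forallP => b; apply: inV.
pose C : subgraph G := exist _ (VC, e |: P) VC_ok.
have Ccyc : is_cycle C.
  apply/andP; split; last first.
    by apply/forall_inP => v vC; rewrite degreeE deg; move: vC; rewrite inE => ->.
  rewrite -(n_comp_connect (@edge_adj_sym (e |: P)) x); apply/eqP/eq_n_comp_r => v.
  apply/idP/idP => [|]; last first.
    have VCcl : closed (edge_adj (e |: P)) VC.
      apply: intro_closed; first exact: edge_adj_sym.
      by move=> u w /edge_adjP[a [b [aC _ <-]]] _; apply: inV.
    by move=> /(closed_connect VCcl) <-; rewrite inE mem_head.
  by rewrite inE => /Pc; apply: sub_connect_edge; apply: subsetUr.
exists (exist _ C Ccyc); split; first exact: setU11.
exact: setUS.
Qed.

Definition acyclic S := [forall C : cycle_of G, ~~ (ES (val C) \subset S)].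

(** Every edge of a forest is a bridge by [cycle_through], so that each edge
    lowers the number of components by one, starting from |V|. *)
Lemma forest_comps S : acyclic S -> (#|S| + comps S)%N = #|vertex G|.
Proof.
have [n] := ubnP #|S|; elim: n S => // n IHn S leSn acS.
have [->|[e eS]] := set_0Vmem S; first by rewrite cards0 comps0.
have acS' : acyclic (S :\ e).
  apply/forallP => C; apply: contra (forallP acS C) => CS.
  exact: subset_trans CS (subsetDl _ _).
have bridge : ~~ connect (edge_adj (S :\ e)) (endpt e false) (endpt e true).
  apply/negP => /(cycle_through (negbT (setD11 e S)))[C [_]]; rewrite setD1K //.
  exact/negP/(forallP acS).
have leSe : (#|S :\ e| < n)%N by move: leSn; rewrite (cardsD1 e) eS.
rewrite -(IHn _ leSe acS') (comps_bridge bridge) setD1K //.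
by rewrite (cardsD1 e S) eS addnS.
Qed.

End EdgeSets.

(** * Potentials and circulations *)

Section Potentials.

Variables (G : mgraph) (A : zmodType).
Implicit Types (S : {set edge G}) (e : edge G) (C : cycle_of G).
Implicit Types (d D : orientation G) (p : vertex G -> A).

Definition tension d p e : A := p (head_of d e) - p (tail_of d e).

(** In a directed cycle every vertex is counted once as a head and once as a
    tail, so the sum telescopes. *)
Lemma sum_tension C d p : is_direction C d ->
  \sum_(e in ES (val C)) tension d p e = 0.
Proof.
move=> hd.
have reach c : (forall v, v \in VS (val C) ->
    #|[set e in ES (val C) | endpt e (c e) == v]| = 1%N) ->
  \sum_(e in ES (val C)) p (endpt e (c e)) = \sum_(v in VS (val C)) p v.
  move=> hc; rewrite (partition_big (fun e => endpt e (c e)) (mem (VS (val C)))).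
    apply: eq_bigr => v /hc hv.
    rewrite (eq_bigr (fun=> p v)) => [|e /andP[_ /eqP->] //].
    rewrite -[RHS]mulr1n -hv -sumr_const; apply: eq_bigl => e.
    by rewrite inE.
  move=> e eC; have /forall_inP /(_ e eC) /forallP := valP (val C); exact.
rewrite sumrB (reach d) => [|v /hd[]//].
by rewrite (reach (fun e => ~~ d e)) ?subrr // => v /hd[].
Qed.

(** Reversing an edge changes the sign of its tension: this is the sign that
    [eta] carries when the orientation of [G] disagrees with the cycle. *)
Lemma tension_signed D d p e :
  tension D p e *~ (if D e == d e then 1 else -1) = tension d p e.
Proof.
rewrite /tension /head_of /tail_of.
by case: (D e); case: (d e); rewrite /= ?mulrNz ?mulr1z ?opprB.
Qed.

End Potentials.

(** The 0/1 potential that marks the component of one end of [e] in the rest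
    of the cycle has no tension on the other edges, hence none on [e]. *)
Lemma cycle_minus_edge_connected (G : mgraph) (C : cycle_of G) d e :
  is_direction C d -> e \in ES (val C) ->
  connect (edge_adj (ES (val C) :\ e)) (endpt e false) (endpt e true).
Proof.
move=> hd eC; set K := connect _ _.
pose p v : int := if K v then 1 else 0.
have flat a : a \in ES (val C) :\ e -> tension d p a = 0.
  move=> aC; rewrite /tension /p /head_of /tail_of.
  have := connect_edge (d a) aC; move/(same_connect_r (@edge_adj_sym _ _)).
  by move=> /(_ (endpt e false)); rewrite -/K => ->; rewrite subrr.
have := sum_tension p hd; rewrite (bigD1 e) //= big1 ?addr0 => [|a /andP[aC ae]].
  rewrite /tension /head_of /tail_of /p.
  have Kx : K (endpt e false) by apply: connect0.
  by case: (d e); rewrite /= Kx; case: (K (endpt e true)).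
by apply: flat; rewrite !inE ae.
Qed.

Section Balance.

Variables (G : mgraph) (D : orientation G) (o : cycle_of G -> orientation G).
Hypothesis ho : forall C : cycle_of G, is_direction C (o C).
Variables (A : zmodType) (f : edge G -> A).
Implicit Types (S : {set edge G}) (e : edge G) (C : cycle_of G).

Definition potential_on S (p : vertex G -> A) := {in S, f =1 tension D p}.

Definition circulation C := \sum_(e in ES (val C)) f e *~ eta D o C e.

(** The tension of [p] contributes nothing around [C], so the circulation is
    that of [f] minus the tension, which lives on [e] alone. *)
Lemma circulation_potential C e p : e \in ES (val C) ->
  potential_on (ES (val C) :\ e) p ->
  circulation C = (f e - tension D p e) *~ eta D o C e.
Proof.
move=> eC hp; rewrite -[LHS]subr0 -(sum_tension p (@ho C)) -sumrB (bigD1 e) //=.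
rewrite big1 ?addr0 => [|a /andP[aC ae]]; rewrite /eta.
  by rewrite eC -(tension_signed D) -mulrzBl.
by rewrite aC hp ?tension_signed ?subrr // !inE ae.
Qed.

Lemma potential_zero C S p : ES (val C) \subset S -> potential_on S p ->
  circulation C = 0.
Proof.
move=> /subsetP CS hp; rewrite -(sum_tension p (@ho C)).
apply: eq_bigr => e eC.
by rewrite hp ?CS // /eta eC tension_signed.
Qed.

Lemma potential_extend C e S p : e \in ES (val C) -> circulation C = 0 ->
  ES (val C) :\ e \subset S -> potential_on S p -> potential_on (e |: S) p.
Proof.
move=> eC C0 /subsetP CS hp a /setU1P[->|/hp//].
have /esym := circulation_potential eC (fun a aC => hp a (CS a aC)).
rewrite C0 /eta eC; case: ifP => _; rewrite ?mulrNz mulr1z => h; apply/eqP.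
  by rewrite -subr_eq0 h.
by rewrite -subr_eq0 -oppr_eq0 h.
Qed.

(** Add the edges one at a time: an edge that completes a cycle already has the
    right tension, since that cycle has zero circulation, and a bridge is
    accommodated by shifting the potential on one of its sides. *)
Lemma balanced_potential S :
  (forall C, ES (val C) \subset S -> circulation C = 0) ->
  exists p, potential_on S p.
Proof.
have [n] := ubnP #|S|; elim: n S => // n IHn S leSn bS.
have [->|[e eS]] := set_0Vmem S; first by exists (fun=> 0) => a; rewrite inE.
have [] := IHn (S :\ e).
- by move: leSn; rewrite (cardsD1 e) eS.
- by move=> C CS; apply: bS; apply: subset_trans CS (subsetDl _ _).
move=> p hp.
have [conn|bridge] :=
  boolP (connect (edge_adj (S :\ e)) (endpt e false) (endpt e true)).
  have [C [eC CS]] := cycle_through (negbT (setD11 e S)) conn.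
  have CS' : ES (val C) :\ e \subset S :\ e by rewrite subDset.
  exists p; rewrite -(setD1K eS); apply: potential_extend eC _ CS' hp.
  by apply: bS; rewrite -(setD1K eS).
pose K := connect (edge_adj (S :\ e)) (head_of D e).
(* Raising the side of the head by the defect of [e] repairs [e] and leaves the
   tension of every other edge unchanged. *)
exists (fun v => p v + if K v then f e - tension D p e else 0).
move=> a aS; rewrite /tension.
have [->|ae] := eqVneq a e.
  have -> : K (head_of D e) by apply: connect0.
  have -> : K (tail_of D e) = false.
    rewrite /K /head_of /tail_of; apply: contraNF bridge.
    by case: (D e); rewrite // edge_adj_sym.
  by rewrite /tension addr0 addrAC addrCA subrr addr0.
have aS' : a \in S :\ e by rewrite !inE ae.
rewrite hp // /tension.
have := connect_edge (D a) aS'; move/(same_connect_r (@edge_adj_sym _ _)).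
move=> /(_ (head_of D e)); rewrite -/K /head_of /tail_of /= => ->.
by set c := (if _ then _ else _); rewrite opprD addrACA subrr addr0.
Qed.

End Balance.

(** * Toggling one element of a set *)

Section Toggle.

Variable E : finType.
Implicit Types (S T : {set E}) (e : E).

Definition toggle e S := if e \in S then S :\ e else e |: S.

Lemma toggleK e : involutive (toggle e).
Proof.
move=> S; rewrite /toggle; have [eS|eS] := boolP (e \in S).
  by rewrite setD11 setD1K.
by rewrite setU11 setU1K.
Qed.

Lemma subset_toggle e T S : e \notin T -> (T \subset toggle e S) = (T \subset S).
Proof.
move=> eT; rewrite /toggle; case: ifP => eS; first by rewrite subsetD1 eT andbT.
apply/idP/idP => h; last exact: subset_trans h (subsetUr _ _).
by rewrite -(setU1K (negbT eS)) subsetD1 h.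
Qed.

Lemma card_toggle_sign (R : pzRingType) e S :
  (-1) ^+ #|toggle e S| = - (-1) ^+ #|S| :> R.
Proof.
rewrite /toggle; case: ifP => eS; last by rewrite cardsU1 eS exprS mulN1r.
by rewrite (cardsD1 e S) eS exprS mulN1r opprK.
Qed.

End Toggle.

(** * Edges that close a broken cycle *)

Lemma ex_least (T : finType) (prec : rel T) (P : pred T) x0 :
  strict_linear_order prec -> P x0 ->
  exists2 x, P x & forall y, P y -> (y == x) || prec x y.
Proof.
case=> irr tr tot Px0.
(* A smaller element has strictly fewer predecessors, so minimize their number. *)
have [x Px xmin] := @arg_minnP _ x0 P (fun x => #|[set y | prec y x]|) Px0.
exists x => // y Py; have [//|yx] := eqVneq y x.
case/orP: (tot _ _ yx) => // pyx.
have := xmin y Py; rewrite leqNgt => /negP[]; apply: proper_card.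
apply/properP; split; last by exists y; rewrite !inE ?irr.
by apply/subsetP => z; rewrite !inE => pzy; apply: tr pyx.
Qed.

Section BrokenCycles.

Variables (G : mgraph) (alpha : assigning G) (prec : rel (edge G)).
Hypothesis hprec : strict_linear_order prec.
Implicit Types (S T : {set edge G}) (e : edge G) (C : cycle_of G).

Definition balanced S := [forall C : cycle_of G, (ES (val C) \subset S) ==> ~~ alpha C].

Lemma compatible_spanning_on S : compatible alpha (spanning_on S) = balanced S.
Proof. by apply: eq_forallb => C; rewrite contained_spanning_on. Qed.

Lemma sub_balanced S T : S \subset T -> balanced T -> balanced S.
Proof.
move=> ST /forallP bT; apply/forallP => C; apply/implyP => CS.
by apply: (implyP (bT C)); apply: subset_trans ST.
Qed.

Definition closes e S :=
  [exists C : cycle_of G,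
     [&& ~~ alpha C, is_max_edge prec (val C) e & ES (val C) :\ e \subset S]].

Lemma broken_cycle_proof (K : subgraph G) e :
  [forall a in (VS K, ES K :\ e).2, forall b, endpt a b \in (VS K, ES K :\ e).1].
Proof.
apply/forall_inP => a /setD1P[_ aK].
by have /forall_inP /(_ a aK) := valP K.
Qed.

(** A spanning subgraph contains all the vertices of a broken cycle, so that only
    the inclusion of its edges is left to test. *)
Lemma no_broken_cycle_spanning_on S :
  no_broken_cycle alpha prec (spanning_on S) = ~~ [exists e, closes e S].
Proof.
rewrite negb_exists; apply/forallP/forallP => [h e|h B].
  apply/negP => /existsP[C /and3P[aC me CS]].
  pose B : subgraph G := exist _ (VS (val C), ES (val C) :\ e) (broken_cycle_proof (val C) e).
  have /implyP := h B; rewrite contained_spanning_on => /(_ _)/negP; apply=> //.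
  by apply/existsP; exists C; apply/existsP; exists e; rewrite aC me !eqxx.
apply/implyP => /existsP[C /existsP[e /and4P[aC me _ /eqP EB]]].
rewrite contained_spanning_on EB; apply: contra (h e) => CS.
by apply/existsP; exists C; rewrite aC me.
Qed.

Definition first_closing e S :=
  closes e S && [forall a, closes a S ==> (a == e) || prec e a].

Lemma ex_first_closing S : [exists e, closes e S] -> exists e, first_closing e S.
Proof.
case/existsP=> e0 he0; have [e he least_e] := ex_least (P := closes^~ S) hprec he0.
exists e; rewrite /first_closing he /=; apply/forallP => a.
exact/implyP/least_e.
Qed.

Lemma first_closing_unique S e a :
  first_closing e S -> first_closing a S -> e = a.
Proof.
case: hprec => irr tr _ /andP[he /forallP me] /andP[ha /forallP ma].
have := implyP (me a) ha; have := implyP (ma e) he.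
case: eqP => //= _ pae; case: eqP => //= _ pea.
by have := tr _ _ _ pae pea; rewrite irr.
Qed.

(** If [a] is not larger than [e], then [e] is not an edge of a broken cycle
    whose removed maximal edge is [a]. *)
Lemma closes_toggle e a S : ~~ prec e a -> closes a (toggle e S) = closes a S.
Proof.
move=> nea; apply: eq_existsb => C.
case: (boolP (is_max_edge _ _ _)) => [/andP[_ /forall_inP ma]|_] /=; last by rewrite !andbF.
congr (_ && _); apply: subset_toggle; apply: contra nea.
by case/setD1P=> ea /ma; rewrite ea.
Qed.

(** Toggling [e] may create or destroy broken cycles, but only those whose
    removed edge is larger than [e], and these do not affect the minimum. *)
Lemma first_closing_toggle e S : first_closing e S -> first_closing e (toggle e S).
Proof.
case: hprec => irr _ _ /andP[he /forallP me].
apply/andP; split; first by rewrite closes_toggle ?irr.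
apply/forallP => a; apply/implyP; have [|nea] := boolP (prec e a); first by rewrite orbT.
by rewrite closes_toggle //; apply/implyP; have := me a; rewrite (negbTE nea).
Qed.

Definition flip S :=
  if [pick e | first_closing e S] is Some e then toggle e S else S.

Lemma flipE e S : first_closing e S -> flip S = toggle e S.
Proof.
move=> he; rewrite /flip; case: pickP => [a ha|/(_ e)]; last by rewrite he.
by rewrite (first_closing_unique he ha).
Qed.

Lemma flipK : involutive flip.
Proof.
move=> S; rewrite {2}/flip; case: pickP => [e he|h].
  by rewrite (flipE (first_closing_toggle he)) toggleK.
by rewrite /flip; case: pickP => // e; rewrite h.
Qed.

Lemma closed_flip S : [exists e, closes e (flip S)] = [exists e, closes e S].
Proof.
rewrite /flip; case: pickP => // e he.
have /andP[ce _] := he; have /andP[ce' _] := first_closing_toggle he.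
by apply/existsP/existsP => _; exists e.
Qed.

Lemma max_edge_exists C (e : edge G) : e \in ES (val C) ->
  exists a, is_max_edge prec (val C) a.
Proof.
case: hprec => irr tr tot eC.
have hconv : strict_linear_order (fun x y => prec y x).
  split=> [x|y x z pyx pzy|x y xy]; rewrite ?irr //; first exact: tr pzy pyx.
  by rewrite orbC tot.
have [a aC amax] := ex_least (P := fun a => a \in ES (val C)) hconv eC.
exists a; rewrite /is_max_edge aC; apply/forall_inP => b bC; apply/implyP.
by case/predU1P: (amax b bC) => [->|//]; rewrite eqxx.
Qed.

(** * Components and compatibility under toggling *)

Section Directed.

Variable (o : cycle_of G -> orientation G).
Hypothesis ho : forall C : cycle_of G, is_direction C (o C).

Lemma cycle_has_edge C : exists e, e \in ES (val C).
Proof.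
have /andP[/eqP c1 _] := valP C.
have [x /andP[_ /= xC]] : exists x, x \in predI (roots (adj (val C))) (mem (VS (val C))).
  by apply/card_gt0P; have := c1; rewrite /ncomp /n_comp_mem => ->.
have [h _] := ho xC.
have /card_gt0P[e] : (0 < #|[set e in ES (val C) | head_of (o C) e == x]|)%N by rewrite h.
by rewrite inE => /andP[eC _]; exists e.
Qed.

Lemma balanced_unbroken_acyclic S :
  balanced S -> ~~ [exists e, closes e S] -> acyclic S.
Proof.
move=> /forallP bS; apply: contraR; rewrite negb_forall => /existsP[C /negPn CS].
have [e0 /max_edge_exists[e me]] := cycle_has_edge C.
apply/existsP; exists e; apply/existsP; exists C.
rewrite me (implyP (bS C) CS) /=; exact: subset_trans (subsetDl _ _) CS.
Qed.

Lemma comps_closes e S : closes e S -> comps (e |: S) = comps S.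
Proof.
case/existsP=> C /and3P[_ /andP[eC _] CS]; apply: comps_cycle_edge.
exact: sub_connect_edge CS (cycle_minus_edge_connected (@ho C) eC).
Qed.

Lemma comps_toggle e S : closes e S -> closes e (toggle e S) ->
  comps (toggle e S) = comps S.
Proof.
rewrite /toggle; case: ifP => eS; last by move/comps_closes.
by move=> _ /comps_closes; rewrite setD1K.
Qed.

Section Admissible.

Variable D : orientation G.
Hypothesis halpha : admissible D o alpha.

(** Admissibility is essential: for an arbitrary assigning the third cycle of a
    theta graph may be incompatible while the two others are compatible. *)
Lemma balanced_closes e S : closes e S -> balanced S -> balanced (e |: S).
Proof.
case: halpha => A [f af]; have alphaE C : alpha C = (circulation D o f C != 0) := af C.
case/existsP=> C /and3P[]; rewrite alphaE negbK => /eqP C0 /andP[eC _] CS bS.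
have [p hp] : exists p, potential_on D f S p.
  apply: (balanced_potential ho) => B BS; apply/eqP; rewrite -[_ == _]negbK -alphaE.
  exact: (implyP (forallP bS B)).
have hp' := potential_extend ho eC C0 CS hp.
apply/forallP => B; apply/implyP => BS.
by rewrite alphaE (potential_zero ho BS hp') eqxx.
Qed.

(** The direction that removes an edge is monotonicity; the one that adds an
    edge is [balanced_closes].  The converse follows since [flip] is its own
    inverse. *)
Lemma balanced_flip S : balanced (flip S) = balanced S.
Proof.
suff half T : balanced T -> balanced (flip T).
  by apply/idP/idP => [/half|/half //]; rewrite flipK.
rewrite /flip; case: pickP => // e /andP[he _] bT.
rewrite /toggle; case: ifP => _; first exact: sub_balanced (subsetDl _ _) bT.
exact: balanced_closes.
Qed.

Definition signed_monomial S : {poly int} := (-1) ^+ #|S| *: 'X^(comps S).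

Lemma signed_monomial_flip S : [exists e, closes e S] ->
  signed_monomial (flip S) = - signed_monomial S.
Proof.
case/ex_first_closing=> e he; have /andP[ce _] := he.
have /andP[ce' _] := first_closing_toggle he.
by rewrite (flipE he) /signed_monomial comps_toggle // card_toggle_sign scaleNr.
Qed.

Lemma sum_broken_eq0 :
  \sum_(S | balanced S && [exists e, closes e S]) signed_monomial S = 0.
Proof.
(* Reindexing by [flip] gives [s = - s], and integers have no 2-torsion. *)
set s := (X in X = 0).
have sN : s = - s.
  rewrite {1}/s (reindex_inj (inv_inj flipK)) -sumrN.
  apply: eq_big => [S|S]; rewrite balanced_flip closed_flip // => /andP[_].
  exact: signed_monomial_flip.
apply/polyP => i; have : s`_i = - s`_i by rewrite -coefN -sN.
by rewrite coef0; lia.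
Qed.

End Admissible.
End Directed.
End BrokenCycles.

(** * The coefficients *)

Lemma big_spanning (R : Type) (idx : R) (op : Monoid.com_law idx) (G : mgraph)
    (Q : pred (subgraph G)) (F : subgraph G -> R) :
  \big[op/idx]_(H | spanning H && Q H) F H =
  \big[op/idx]_(S | Q (spanning_on S)) F (spanning_on S).
Proof.
rewrite (reindex_onto (@spanning_on G) (@ES G)); last first.
  by move=> H /andP[/spanning_onK].
by apply: eq_bigl => S; rewrite spanning_on_spanning eqxx andbT.
Qed.

Theorem theorem4p2 (G : mgraph) (D : orientation G)
    (o : cycle_of G -> orientation G)
    (ho : forall C : cycle_of G, is_direction C (o C))
    (alpha : assigning G) (halpha : admissible D o alpha)
    (prec : rel (edge G)) (hprec : strict_linear_order prec) :
  cycle_assigning_poly alpha =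
    \sum_(i < (grank G).+1)
       ((-1) ^+ i * unsigned_coef alpha i) *: 'X^(#|vertex G| - i)
  /\ (forall i : nat, (i <= grank G)%N ->
        unsigned_coef alpha i =
          #|[set H : subgraph G | [&& spanning H, compatible alpha H,
                                      #|ES H| == i
                                    & no_broken_cycle alpha prec H]]|%:Z).
Proof.
pose good S := balanced alpha S && ~~ [exists e, closes alpha prec e S].
pose N (i : nat) := (\sum_(S | good S && (#|S| == i)) 1)%N.
have rankE : grank G = (#|vertex G| - comps [set: edge G])%N.
  by rewrite /grank -ncomp_spanning_on; congr (_ - ncomp _)%N; apply: val_inj.
have le_rank : (grank G <= #|vertex G|)%N by rewrite rankE leq_subr.
have good_comps S : good S -> (#|S| + comps S)%N = #|vertex G|.
  by case/andP=> bS /(balanced_unbroken_acyclic hprec ho bS); apply: forest_comps.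
have good_rank S : good S -> (#|S| < (grank G).+1)%N.
  by move=> /good_comps Sn; rewrite rankE ltnS -Sn -addnBA ?leq_addr ?comps_setT.
have polyE : cycle_assigning_poly alpha =
    \sum_(i < (grank G).+1) ((-1) ^+ i * (N i)%:Z) *: 'X^(#|vertex G| - i).
  rewrite /cycle_assigning_poly big_spanning.
  rewrite (eq_bigl (balanced alpha)) => [|S]; last exact: compatible_spanning_on.
  rewrite (eq_bigr (@signed_monomial G)) => [|S _]; last by rewrite ncomp_spanning_on.
  rewrite (bigID (fun S => [exists e, closes alpha prec e S])) /=.
  rewrite (sum_broken_eq0 hprec ho halpha) add0r.
  rewrite (partition_big (fun S : {set edge G} => inord #|S| : 'I_(grank G).+1) xpredT) //=.
  apply: eq_bigr => i _.
  rewrite (eq_bigl (fun S => good S && (#|S| == i))); last first.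
    move=> S; rewrite -/(good S); apply: andb_id2l => /good_rank lt_r.
    by rewrite -val_eqE /= inordK.
  rewrite /N (big_morph Posz PoszD (erefl _)) mulr_sumr scaler_suml.
  apply: eq_bigr => S /andP[/good_comps <- /eqP <-].
  by rewrite mulr1 addKn.
have coefE i : (i <= grank G)%N -> unsigned_coef alpha i = (N i)%:Z.
  move=> le_i; rewrite /unsigned_coef polyE coef_sum.
  have lt_i : (i < (grank G).+1)%N by [].
  rewrite (bigD1 (Ordinal lt_i)) //= big1 ?addr0 => [|j ji].
    by rewrite coefZ coefXn eqxx mulr1 mulrA -signr_odd; case: odd; rewrite ?mulrNN ?mulr1 ?mul1r.
  rewrite coefZ coefXn; case: eqP => [|_]; last by rewrite mulr0.
  move=> eq_ij; case/eqP: ji; apply: val_inj => /=.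
  rewrite -[RHS](subKn (leq_trans le_i le_rank)) eq_ij subKn //.
  by apply: leq_trans le_rank; rewrite -ltnS.
split=> [|i le_i].
  by rewrite polyE; apply: eq_bigr => i _; rewrite coefE // -ltnS.
rewrite coefE //; congr Posz; rewrite -sum1dep_card big_spanning.
apply: eq_bigl => S; rewrite compatible_spanning_on no_broken_cycle_spanning_on /good.
by rewrite -andbA; congr (_ && _); rewrite andbC.
Qed.
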